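(* Suppose that $\mathcal{L}(w;\boldsymbol{t})$ is a solution of the dKP hierarchy whose dependence on $\boldsymbol{t}=(x+t_1,t_2,t_3,\ldots)$ is through a single variable $\lambda$; that is, there exists a function $\lambda(\boldsymbol{t})$ of $\boldsymbol{t}$ such that $$\mathcal{L}(w;\boldsymbol{t})=\mathcal{L}(w,\lambda(\boldsymbol{t}))=w+\sum_{n=1}^{\infty}u_{n+1}(\lambda(\boldsymbol{t}))\,w^{-n}.$$ Then $\mathcal{L}(w,\lambda)$ satisfies the chordal L\''owner equation with respect to $\lambda$; that is, there is a function $U(\lambda)$, independent of $w$, such that $$\frac{\partial \mathcal{L}(w,\lambda)}{\partial\lambda}=-\frac{\partial \mathcal{L}(w,\lambda)}{\partial w}\,\frac{1}{U(\lambda)-w}\,\frac{\partial u_2(\lambda)}{\partial\lambda}.$$ Moreover, let $k(z,\lambda)$ be the inverse function of $\mathcal{L}(w,\lambda)$ with respect to $w$, let $\Phi_n(w,\lambda)$, $n\ge 1$, be the Faber polynomials of $k(z,\lambda)$, and let $\chi_n(\lambda)=\Phi_n'(U(\lambda),\lambda)$, where $'$ denotes $\partial/\partial w$. Then $\lambda(\boldsymbol{t})$ satisfies the hydrodynamic type equation $$\frac{\partial\lambda}{\partial t_n}=\chi_n(\lambda)\,\frac{\partial\lambda}{\partial t_1},\qquad n\ge 1.$$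
   Context: dKP hierarchy. Its unknown is a formal power series $\mathcal{L}(w;\boldsymbol{t})=w+\sum_{n=1}^{\infty}u_{n+1}(\boldsymbol{t})w^{-n}$ in $w$ whose coefficients are functions of the independent variables $\boldsymbol{t}=(x+t_1,t_2,t_3,\ldots)$; in particular $x$ and $t_1$ enter only through $x+t_1$. The series is a solution of the dKP hierarchy if for all $n\ge 1$ $$\frac{\partial\mathcal{L}}{\partial t_n}=\{\mathcal{B}_n,\mathcal{L}\},\qquad \mathcal{B}_n=(\mathcal{L}^n)_{\ge 0},\qquad \{h_1,h_2\}=\frac{\partial h_1}{\partial w}\frac{\partial h_2}{\partial x}-\frac{\partial h_1}{\partial x}\frac{\partial h_2}{\partial w}.$$ Here, for $S\subset\mathbb{Z}$, $(\sum_k A_kw^k)_S=\sum_{k\in S}A_kw^k$, and the subscript $\ge 0$ denotes the set of non-negative exponents. Inverse function. $k(z,\lambda)=z+O(z^{-1})$ is the formal series in $z$ near $z=\infty$ with $\mathcal{L}(k(z,\lambda),\lambda)=z$ and $k(\mathcal{L}(w,\lambda),\lambda)=w$. Faber polynomials. For $k(z,\lambda)=z+O(z^{-1})$, the Faber polynomials $\Phi_n(w,\lambda)$ (polynomials in $w$), $n\ge1$, are defined by $$\log\frac{k(z,\lambda)-w}{z}=-\sum_{n=1}^{\infty}\frac{\Phi_n(w,\lambda)}{n}z^{-n};$$ equivalently $\Phi_n(w,\lambda)=(\mathcal{L}(w,\lambda)^n)_{\ge 0}$. Chordal L\''owner equation. For a family $H(w,\lambda)=w+a_1(\lambda)w^{-1}+a_2(\lambda)w^{-2}+\ldots$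 it is the equation $\partial_\lambda H=-\partial_w H\,\frac{1}{U(\lambda)-w}\,\partial_\lambda a_1$ with some function $U(\lambda)$; for $H=\mathcal{L}$ one has $a_1=u_2$. It is read here as an identity of formal Laurent series at $w=\infty$, with $1/(U(\lambda)-w)$ expanded in powers of $w^{-1}$.
   Formalization: The formal theorem also assumes that each value of λ is taken at some time where some ∂L/∂t_n is nonzero; without this the claim fails, e.g. for L = w with λ = t_1 + t_2, or for λ constant. Coefficients u_n and λ are assumed differentiable. *)

(* Defs.v *)
From mathcomp Require Import all_boot all_order all_algebra.
From mathcomp Require Import all_classical all_reals all_analysis.
Set Implicit Arguments.
Unset Strict Implicit.
Unset Printing Implicit Defensive.
Import Order.TTheory GRing.Theory Num.Theory.
Import numFieldNormedType.Exports.
Local Open Scope classical_set_scope.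
Local Open Scope ring_scope.

(** * Formal Laurent series at infinity

    [F : laurent R] stands for [\sum_k F k w^k].  Only series whose exponents
    are bounded above are meaningful; for these, every sum [\sum_(_ \in _)]
    below (sum of a finitely supported family, 0 otherwise) has finite
    support, coefficient by coefficient. *)
Definition laurent (R : Type) := int -> R.

Section Series.
Variable R : comNzRingType.
Implicit Types F G : laurent R.

Definition smono (m : int) : laurent R := fun k => (k == m)%:R.

Definition sadd F G : laurent R := fun k => F k + G k.
Definition ssub F G : laurent R := fun k => F k - G k.

Definition smul F G : laurent R :=
  fun k => \sum_(i \in [set: int]) F i * G (k - i).

Definition sexp F (n : nat) : laurent R := iter n (smul F) (smono 0).

(* (\sum_k A_k w^k)_{>= 0} *)
Definition snneg F : laurent R := fun k => if 0 <= k then F k else 0.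

(* derivative with respect to the series variable *)
Definition sderiv F : laurent R := fun k => F (k + 1) *~ (k + 1).

(* w + \sum_(n >= 1) a_n w^(-n); recall that [Negz m] is [- (m + 1)] *)
Definition wseries (a : nat -> R) : laurent R :=
  fun k => if k is Negz m then a m.+1 else (k == 1)%:R.

(* 1 / (U - w) = - \sum_(m >= 0) U^m w^(-m-1) *)
Definition inv_sub_w (U : R) : laurent R :=
  fun k => if k is Negz m then - U ^+ m else 0.

(* Inverse of F = w + O(1), by the geometric series:
   w^(-1) \sum_j (1 - w^(-1) F)^j *)
Definition sinv F : laurent R :=
  smul (smono (-1))
    (fun k => \sum_(j \in [set: nat])
                sexp (ssub (smono 0) (smul (smono (-1)) F)) j k).

Definition sexpz F (i : int) : laurent R :=
  match i with Posz n => sexp F n | Negz n => sexp (sinv F) n.+1 end.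

(* F(G(z)) = \sum_i F_i G(z)^i, for G = z + O(1) *)
Definition scomp F G : laurent R :=
  fun k => \sum_(i \in [set: int]) F i * sexpz G i k.

(* f and g are inverse to each other for composition; [smono 1] is the
   series reduced to its variable *)
Definition sinverse F G : Prop :=
  scomp F G = smono 1 /\ scomp G F = smono 1.

End Series.

Arguments smono {R} m.

(** * Faber polynomials *)
Section Faber.
Variable K : numFieldType.

(* log F = \sum_(j >= 0) (-1)^j / (j+1) (F - 1)^(j+1), for F = 1 + O(z^(-1)) *)
Definition slog (F : laurent {poly K}) : laurent {poly K} :=
  fun k => \sum_(j \in [set: nat])
    ((-1) ^+ j / j.+1%:R) *: sexp (ssub F (smono 0)) j.+1 k.

(* (k(z) - w) / z, a series in z with coefficients in K[w], w = 'X *)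
Definition faber_arg (k : laurent K) : laurent {poly K} :=
  smul (smono (-1)) (fun i => (k i)%:P - 'X * smono 0 i).

(* log ((k(z) - w) / z) = - \sum_(n >= 1) Phi_n(w) / n z^(-n) *)
Definition faber (k : laurent K) (n : nat) : {poly K} :=
  - (n%:R *: slog (faber_arg k) (- n%:Z)).

End Faber.

(** * The dKP hierarchy *)
Section DKP.
Variable K : numFieldType.

(* The independent variables (x + t_1, t_2, t_3, ...): [t i] is the variable
   of index [i + 1], so that [t 0] is x + t_1. *)
Definition times := nat -> K.

(* For n >= 1, f as a function of its n-th variable alone. *)
Definition slice (n : nat) (f : times -> K) (t : times) : K -> K :=
  fun s => f [eta t with n.-1 |-> s].

Definition has_dt (n : nat) (f : times -> K) (t : times) : Prop :=
  derivable (slice n f t) (t n.-1) 1.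

Definition dt (n : nat) (f : times -> K) (t : times) : K :=
  derive1 (slice n f t) (t n.-1).

(* x enters only through x + t_1 *)
Definition dx (f : times -> K) (t : times) : K := dt 1 f t.

Definition sdx (h : times -> laurent K) (t : times) : laurent K :=
  fun k => dx (fun t' => h t' k) t.

Definition poisson (h1 h2 : times -> laurent K) (t : times) : laurent K :=
  ssub (smul (sderiv (h1 t)) (sdx h2 t)) (smul (sdx h1 t) (sderiv (h2 t))).

(* w + \sum_(n >= 1) u_{n+1} w^(-n); u_0 and u_1 are not used *)
Definition lax (u : nat -> K) : laurent K := wseries (fun n => u n.+1).

Definition dKP_solution (T : set times) (v : nat -> times -> K) : Prop :=
  let L t := lax (v^~ t) in
  let B n t := snneg (sexp (L t) n) in
  forall t, T t -> forall n, (1 <= n)%N ->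
    (forall k, has_dt n (fun t' => L t' k) t) /\
    (forall k, dt n (fun t' => L t' k) t = poisson (B n) L t k).

(* The chordal Loewner equation at the parameter value l, for
   L(w, l) = w + \sum_(n >= 1) u_{n+1}(l) w^(-n) and the driving function U *)
Definition chordal_loewner (u : nat -> K -> K) (U : K -> K) (l : K) : Prop :=
  let L l' := lax (u^~ l') in
  forall k, derive1 (fun l' => L l' k) l =
    - smul (sderiv (L l)) (inv_sub_w (U l)) k * derive1 (u 2%N) l.

(* Each value of lam is taken at some t in T where L(w; t) = L(w, lam(t)) is
   not stationary.  Without such a condition the reduction can be vacuous:
   for L = w every lam is allowed, and for lam constant every L with
   differentiable coefficients is. *)
Definition genuine_reduction (T : set times) (lam : times -> K)
    (u : nat -> K -> K) : Prop :=
  forall l, (lam @` T) l -> exists t n m,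
    [/\ T t, lam t = l, (1 <= n)%N, (2 <= m)%N
      & dt n (fun t' => u m (lam t')) t != 0].

End DKP.

(* Main.v *)
Require Import Defs.
From HB Require Import structures.
From mathcomp Require Import all_boot all_order all_algebra.
From mathcomp Require Import all_classical all_reals all_analysis.
From mathcomp Require Import zify ring.
Import Order.TTheory GRing.Theory Num.Theory.
Import numFieldNormedType.Exports.
Local Open Scope classical_set_scope.
Local Open Scope ring_scope.

(** Write L' for the w-derivative of L, Ld for its lambda-derivative, D_n for
    the n-th time derivative of lambda, B_n for (L^n)_{>= 0} and Res for the
    coefficient of w^(-1).  By the chain rule the n-th dKP flow becomes

      D_n Ld = D_1 B_n' Ld - q L',   where q = dB_n/dx.          ([reduced_flow])

    All that matters about q is that it has no negative powers of w, whereas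
    Ld has only negative ones, so that dividing by L' = 1 + O(w^(-2)) and
    comparing exponents determines everything.

    _The driving function._  If D_1 were 0, then -q = D_n Ld / L' would have
    only negative powers, so q = 0 and D_n Ld = 0 for every n, against the
    genuineness of the reduction ([reduced_flow_stationary]).  For n = 2 one
    has B_2' = 2w, hence q is O(1), a constant, and its value is 2 D_1 u_2'.
    The second flow is then (w - c) Ld = u_2' L' with c = D_2 / (2 D_1): this
    is the Loewner equation with U = c ([second_flow_loewner]).  In
    particular u_2' is nonzero, since Ld is.

    _The speeds._  Substitute Ld = u_2' L' / (w - U) in the n-th flow and
    divide by L':  D_n u_2' / (w - U) = D_1 u_2' B_n' / (w - U) - q.  The
    residue does not see q and gives D_n = D_1 Res (B_n' / (w - U))
    ([reduced_flow_speed]); this residue is B_n'(U).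

    _Faber polynomials._  Differentiating the generating series in w yields
    Phi_n'(U) = n [z^(-n)] 1 / (k(z) - U), the coefficient of z^(-1) in
    n z^(n-1) / (k(z) - U) ([faber_deriv_horner]).  Residues are invariant
    under the substitution z = L(w) ([residue_comp]), which turns this one
    into Res ((L^n)' / (w - U)); the negative part of L^n contributes O(w^(-3))
    and can be dropped ([faber_deriv_residue]).

    These computations take place in the commutative ring [lseries R] of
    Laurent series with exponents bounded above.  The identities between
    operations on it (associativity, Leibniz rule, multiplicativity of
    composition, invariance of residues) all hold for the same reason: both
    sides are additive and continuous for the topology given by the exponents,
    and they agree on monomials ([additive_eq_on_mono],
    [operator_eq_on_mono]). *)

Set Implicit Arguments.
Unset Strict Implicit.
Unset Printing Implicit Defensive.

(** * Finite windows of integers *)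
Definition zrange (a b : int) : seq int :=
  [seq a + j%:Z | j <- iota 0 `|b - a|.+1].

Lemma mem_zrange (a b i : int) : a <= i <= b -> i \in zrange a b.
Proof.
move=> ?; apply/mapP; exists `|i - a|%N; last lia.
by rewrite mem_iota; lia.
Qed.

Lemma zrange_uniq (a b : int) : uniq (zrange a b).
Proof. by rewrite map_inj_uniq ?iota_uniq// => j j'; lia. Qed.

Lemma fsum_zrange (V : nmodType) (f : int -> V) (a b : int) :
    (forall i, f i != 0 -> a <= i <= b) ->
  \sum_(i \in [set: int]) f i = \sum_(i <- zrange a b) f i.
Proof.
move=> fab; rewrite (fsbigE (zrange a b)) ?zrange_uniq//.
  by apply: eq_bigl => i; rewrite in_setT.
move=> i _; apply: contraNeq => /fab; exact: mem_zrange.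
Qed.

Definition deg_le (V : nmodType) (N : int) (F : int -> V) : Prop :=
  forall k, N < k -> F k = 0.

Lemma deg_le_trans (V : nmodType) (M N : int) (F : int -> V) :
  M <= N -> deg_le M F -> deg_le N F.
Proof. by move=> MN FM k Nk; apply: FM; lia. Qed.

(** * The ring of Laurent series with exponents bounded above *)
Section SeriesType.
Variable R : comNzRingType.

Record lseries := LSeries {
  lcoef :> int -> R;
  _ : `[< exists N, deg_le N lcoef >] }.

HB.instance Definition _ := [isSub for lcoef].
HB.instance Definition _ := [Choice of lseries by <:].

Lemma lseriesP (F G : lseries) : (forall k, F k = G k) -> F = G.
Proof. by move=> FG; apply: val_inj; apply/funext => k; exact: FG. Qed.

Lemma lseries_bounded (F : lseries) : exists N, deg_le N F.
Proof. by case: F => F /= /asboolP. Qed.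

Lemma lseries_bounded2 (F G : lseries) : exists N, deg_le N F /\ deg_le N G.
Proof.
have [[M FM] [N GN]] := (lseries_bounded F, lseries_bounded G).
exists (Num.max M N); split; [move: FM|move: GN]; apply: deg_le_trans; lia.
Qed.

Lemma zero_series_subproof : `[< exists N, deg_le N (fun=> 0 : R) >].
Proof. by apply/asboolP; exists 0 => k. Qed.

(** Total, so that operations can be defined by a formula for their
    coefficients before the bound on the exponents is known. *)
Definition to_lseries (f : int -> R) : lseries :=
  insubd (LSeries zero_series_subproof) f.

Lemma to_lseriesE (f : int -> R) (N : int) :
  deg_le N f -> to_lseries f = f :> (int -> R).
Proof. by move=> fN; apply: insubdK; apply/asboolP; exists N. Qed.

Definition mono (c : R) (i : int) : lseries :=
  to_lseries (fun k => if k == i then c else 0).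

Lemma lcoef_mono c i k : mono c i k = if k == i then c else 0.
Proof.
by rewrite /mono (@to_lseriesE _ i)// => l il; case: eqP => // ?; lia.
Qed.

Definition lseries_add (F G : lseries) := to_lseries (fun k => F k + G k).
Definition lseries_opp (F : lseries) := to_lseries (fun k => - F k).

Lemma lcoef_lseries_add F G k : lseries_add F G k = F k + G k.
Proof.
have [N [FN GN]] := lseries_bounded2 F G.
by rewrite (@to_lseriesE _ N)// => l Nl; rewrite FN// GN// addr0.
Qed.

Lemma lcoef_lseries_opp F k : lseries_opp F k = - F k.
Proof.
have [N FN] := lseries_bounded F.
by rewrite (@to_lseriesE _ N)// => l Nl; rewrite FN// oppr0.
Qed.

Lemma lseries_addA : associative lseries_add.
Proof. by move=> F G H; apply: lseriesP => k; rewrite !lcoef_lseries_add addrA. Qed.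

Lemma lseries_addC : commutative lseries_add.
Proof. by move=> F G; apply: lseriesP => k; rewrite !lcoef_lseries_add addrC. Qed.

Lemma lseries_add0 : left_id (mono 0 0) lseries_add.
Proof.
by move=> F; apply: lseriesP => k; rewrite lcoef_lseries_add lcoef_mono if_same
  add0r.
Qed.

Lemma lseries_addN : left_inverse (mono 0 0) lseries_opp lseries_add.
Proof.
move=> F; apply: lseriesP => k.
by rewrite lcoef_lseries_add lcoef_lseries_opp lcoef_mono if_same addNr.
Qed.

HB.instance Definition _ :=
  GRing.isZmodule.Build lseries lseries_addA lseries_addC lseries_add0 lseries_addN.

Lemma lcoef0 k : (0 : lseries) k = 0.
Proof. by rewrite lcoef_mono if_same. Qed.

Lemma lcoefD (F G : lseries) k : (F + G) k = F k + G k.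
Proof. exact: lcoef_lseries_add. Qed.

Lemma lcoefN (F : lseries) k : (- F) k = - F k.
Proof. exact: lcoef_lseries_opp. Qed.

Lemma lcoefB (F G : lseries) k : (F - G) k = F k - G k.
Proof. by rewrite lcoefD lcoefN. Qed.

Lemma lcoef_sum (I : Type) (r : seq I) (P : pred I) (F : I -> lseries) k :
  (\sum_(i <- r | P i) F i) k = \sum_(i <- r | P i) F i k.
Proof.
exact: (big_morph (fun G : lseries => G k) (fun F G => lcoefD F G k) (lcoef0 k)).
Qed.

Lemma lcoefMn (F : lseries) n k : (F *+ n) k = F k *+ n.
Proof. by elim: n => [|n IH]; rewrite ?lcoef0// !mulrS lcoefD IH. Qed.

Lemma lcoefMz (F : lseries) (n : int) k : (F *~ n) k = F k *~ n.
Proof. by case: n => n; rewrite ?NegzE ?mulrNz ?lcoefN lcoefMn. Qed.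

Lemma deg_leB N (F G : lseries) : deg_le N F -> deg_le N G -> deg_le N (F - G).
Proof. by move=> FN GN k Nk; rewrite lcoefB FN// GN// subrr. Qed.

Lemma deg_leN N (F : lseries) : deg_le N F -> deg_le N (- F).
Proof. by move=> FN k Nk; rewrite lcoefN FN// oppr0. Qed.

Lemma deg_leD N (F G : lseries) : deg_le N F -> deg_le N G -> deg_le N (F + G).
Proof. by move=> FN GN k Nk; rewrite lcoefD FN// GN// addr0. Qed.

Lemma deg_le_mono c i : deg_le i (mono c i).
Proof. by move=> k ik; rewrite lcoef_mono; case: eqP => //; lia. Qed.

(** Monomials span a dense subgroup: removing the leading term of [F] finitely
    many times leaves a series of exponents at most [N], on which both maps
    vanish. *)
Lemma additive_eq_on_mono (V : zmodType) (phi psi : lseries -> V) (N : int) :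
    {morph phi : F G / F + G} -> {morph psi : F G / F + G} ->
    (forall F : lseries, deg_le N F -> phi F = 0) ->
    (forall F : lseries, deg_le N F -> psi F = 0) ->
    (forall c i, phi (mono c i) = psi (mono c i)) ->
  phi =1 psi.
Proof.
move=> phiD psiD phiN psiN eq_mono F.
have [M FM] := lseries_bounded F.
have {FM}: deg_le (N + `|M - N|%N%:Z) F by apply: deg_le_trans FM; lia.
elim: `|M - N|%N F => [|n IH] F FN.
  by rewrite addr0 in FN; rewrite phiN// psiN.
pose k := N + n.+1%:Z; pose lead := mono (F k) k.
rewrite -(subrK lead F) phiD psiD eq_mono IH// => j Nj.
rewrite lcoefB lcoef_mono; case: eqP => [->|jk]; first by rewrite subrr.
by rewrite subr0 FN//; lia.
Qed.

Definition lseries_mul (F G : lseries) : lseries := to_lseries (smul F G).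

(** On a common window, convolutions of different series become sums over the
    same list, and the ring laws can be read off termwise. *)
Lemma smul_window (M N k a b : int) (F G : int -> R) :
    deg_le M F -> deg_le N G -> a <= k - N -> M <= b ->
  smul F G k = \sum_(i <- zrange a b) F i * G (k - i).
Proof.
move=> FM GN ak Nb; apply: fsum_zrange => i; apply: contraR => out.
have [iM|/FM ->] := leP i M; last by rewrite mul0r.
by rewrite (GN (k - i)) ?mulr0//; lia.
Qed.

Lemma deg_le_smul (M N : int) (F G : int -> R) :
  deg_le M F -> deg_le N G -> deg_le (M + N) (smul F G).
Proof.
move=> FM GN k MNk; apply: fsbig1 => i _.
have [iM|/FM ->] := leP i M; last by rewrite mul0r.
by rewrite (GN (k - i)) ?mulr0//; lia.
Qed.

Lemma lcoef_lseries_mul F G : lseries_mul F G = smul F G :> (int -> R).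
Proof.
have [M FM] := lseries_bounded F; have [N GN] := lseries_bounded G.
exact: to_lseriesE (deg_le_smul FM GN).
Qed.

Lemma deg_le_lseries_mul (M N : int) (F G : lseries) :
  deg_le M F -> deg_le N G -> deg_le (M + N) (lseries_mul F G).
Proof. by rewrite lcoef_lseries_mul; exact: deg_le_smul. Qed.

Lemma lseries_mulDl : left_distributive lseries_mul +%R.
Proof.
move=> F G H; apply: lseriesP => k.
have [M [FM GM]] := lseries_bounded2 F G; have [N HN] := lseries_bounded H.
rewrite lcoefD !lcoef_lseries_mul !(@smul_window M N k (k - N) M)//; last first.
  exact: deg_leD.
by rewrite -big_split/=; apply: eq_bigr => i _; rewrite lcoefD mulrDl.
Qed.

Lemma lseries_mulDr : right_distributive lseries_mul +%R.
Proof.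
move=> H F G; apply: lseriesP => k.
have [M [FM GM]] := lseries_bounded2 F G; have [N HN] := lseries_bounded H.
rewrite lcoefD !lcoef_lseries_mul !(@smul_window N M k (k - M) N)//; last first.
  exact: deg_leD.
by rewrite -big_split/=; apply: eq_bigr => i _; rewrite lcoefD mulrDr.
Qed.

Lemma lcoef_mono_mul c i F k : lseries_mul (mono c i) F k = c * F (k - i).
Proof.
rewrite lcoef_lseries_mul /smul (@fsum_zrange _ _ i i) => [|j]; last first.
  by rewrite lcoef_mono; case: (j =P i) => [->|]; rewrite ?lexx// mul0r eqxx.
by rewrite /zrange subrr/= big_seq1 lcoef_mono addr0 eqxx.
Qed.

Lemma mono_mul c d i j :
  lseries_mul (mono c i) (mono d j) = mono (c * d) (i + j).
Proof.
apply: lseriesP => k; rewrite lcoef_mono_mul !lcoef_mono.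
have -> : (k - i == j) = (k == i + j) by lia.
by case: eqP; rewrite ?mulr0.
Qed.

(** A quantitative form of continuity for the topology in which the series of
    exponents at most [N] are the basic neighbourhoods of 0. *)
Definition bounded_shift (f : lseries -> lseries) : Prop :=
  exists c : int, forall N (F : lseries), deg_le N F -> deg_le (N + c) (f F).

Lemma bounded_shift_mull F : bounded_shift (lseries_mul F).
Proof.
have [M FM] := lseries_bounded F; exists M => N G GN.
by rewrite addrC; exact: deg_le_lseries_mul.
Qed.

Lemma bounded_shift_mulr F : bounded_shift (lseries_mul^~ F).
Proof.
have [M FM] := lseries_bounded F; exists M => N G GN; exact: deg_le_lseries_mul.
Qed.

Lemma bounded_shift_comp f g :
  bounded_shift f -> bounded_shift g -> bounded_shift (f \o g).
Proof.
move=> [c fc] [d gd]; exists (d + c) => N F FN.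
by rewrite addrA; apply/fc/gd.
Qed.

Lemma bounded_shiftD f g :
  bounded_shift f -> bounded_shift g -> bounded_shift (fun F => f F + g F).
Proof.
move=> [c fc] [d gd]; exists (Num.max c d) => N F FN.
by apply: deg_leD; [apply: deg_le_trans (fc _ _ FN)|
  apply: deg_le_trans (gd _ _ FN)]; lia.
Qed.

Lemma operator_eq_on_mono (f g : lseries -> lseries) :
    {morph f : F G / F + G} -> {morph g : F G / F + G} ->
    bounded_shift f -> bounded_shift g ->
    (forall c i, f (mono c i) = g (mono c i)) ->
  f =1 g.
Proof.
move=> fD gD [c fc] [d gd] eq_mono F; apply: lseriesP => k.
(* below this exponent neither image reaches the coefficient of index k *)
pose N := k - 1 - Num.max c d.
apply: (@additive_eq_on_mono R (fun F => f F k) (fun F => g F k) N) => //.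
- by move=> G H; rewrite fD lcoefD.
- by move=> G H; rewrite gD lcoefD.
- by move=> G GN; apply: (fc _ _ GN); rewrite /N; lia.
- by move=> G GN; apply: (gd _ _ GN); rewrite /N; lia.
- by move=> a i; rewrite eq_mono.
Qed.

(** By density it is enough to treat monomials, one argument after the other. *)
Lemma lseries_mulC : commutative lseries_mul.
Proof.
move=> F G; apply: (@operator_eq_on_mono (lseries_mul^~ G) (lseries_mul G)) F.
- by move=> F H; rewrite lseries_mulDl.
- by move=> F H; rewrite lseries_mulDr.
- exact: bounded_shift_mulr.
- exact: bounded_shift_mull.
move=> c i; apply: (@operator_eq_on_mono (lseries_mul (mono c i))
  (lseries_mul^~ (mono c i))) G.
- by move=> F H; rewrite lseries_mulDr.
- by move=> F H; rewrite lseries_mulDl.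
- exact: bounded_shift_mull.
- exact: bounded_shift_mulr.
by move=> d j; rewrite !mono_mul mulrC addrC.
Qed.

Lemma lseries_mulA : associative lseries_mul.
Proof.
move=> F G H.
apply: (@operator_eq_on_mono (lseries_mul^~ (lseries_mul G H))
   (fun F => lseries_mul (lseries_mul F G) H)) F.
- by move=> F1 F2; rewrite lseries_mulDl.
- by move=> F1 F2; rewrite !lseries_mulDl.
- exact: bounded_shift_mulr.
- exact: bounded_shift_comp (bounded_shift_mulr _) (bounded_shift_mulr _).
move=> c i.
apply: (@operator_eq_on_mono (fun G => lseries_mul (mono c i) (lseries_mul G H))
   (fun G => lseries_mul (lseries_mul (mono c i) G) H)) G.
- by move=> F1 F2; rewrite lseries_mulDl lseries_mulDr.
- by move=> F1 F2; rewrite lseries_mulDr lseries_mulDl.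
- exact: bounded_shift_comp (bounded_shift_mull _) (bounded_shift_mulr _).
- exact: bounded_shift_comp (bounded_shift_mulr _) (bounded_shift_mull _).
move=> d j; apply: lseriesP => k.
by rewrite mono_mul !lcoef_mono_mul mulrA opprD addrA.
Qed.

Lemma lseries_mul1 : left_id (mono 1 0) lseries_mul.
Proof.
by move=> F; apply: lseriesP => k; rewrite lcoef_mono_mul mul1r subr0.
Qed.

Lemma lseries_one_neq0 : mono 1 0 != 0.
Proof.
apply/eqP => /(congr1 (fun F : lseries => F 0)).
by rewrite lcoef0 lcoef_mono eqxx => /eqP; rewrite oner_eq0.
Qed.

HB.instance Definition _ := GRing.Zmodule_isComNzRing.Build lseries
  lseries_mulA lseries_mulC lseries_mul1 lseries_mulDl lseries_one_neq0.

Definition lseries_unit : {pred lseries} :=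
  fun F => `[< exists G : lseries, G * F = 1 >].
(** Defined by choice, so that inverses and integer powers of units come with
    the general theory of unit rings. *)
Definition lseries_inv (F : lseries) : lseries :=
  if pselect (exists G : lseries, G * F = 1) is left e then projT1 (cid e) else F.

Lemma lseries_mulV : {in lseries_unit, left_inverse 1 lseries_inv *%R}.
Proof.
move=> F; rewrite unfold_in /lseries_inv => /asboolP e.
by case: pselect => // e'; case: cid.
Qed.

Lemma lseries_unitP (F G : lseries) : G * F = 1 -> lseries_unit F.
Proof. by move=> GF; apply/asboolP; exists G. Qed.

Lemma lseries_inv_out : {in [predC lseries_unit], lseries_inv =1 id}.
Proof.
move=> F; rewrite inE unfold_in /lseries_inv => /asboolPn e.
by case: pselect.
Qed.

HB.instance Definition _ := GRing.ComNzRing_hasMulInverse.Build lseries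
  lseries_mulV lseries_unitP lseries_inv_out.
End SeriesType.

Section SeriesTheory.
Variable R : comNzRingType.
Implicit Types F G H : lseries R.

Lemma lcoefM F G : F * G = smul F G :> (int -> R).
Proof. exact: lcoef_lseries_mul. Qed.

Lemma lcoef1 k : (1 : lseries R) k = (k == 0)%:R.
Proof. by rewrite lcoef_mono; case: eqP. Qed.

Lemma lcoef_monoM c i F k : (mono c i * F) k = c * F (k - i).
Proof. exact: lcoef_mono_mul. Qed.

Lemma monoM c d i j : mono c i * mono d j = mono (c * d) (i + j) :> lseries R.
Proof. exact: mono_mul. Qed.

Lemma deg_leM M N F G : deg_le M F -> deg_le N G -> deg_le (M + N) (F * G).
Proof. exact: deg_le_lseries_mul. Qed.

Lemma deg_le1 : deg_le 0 (1 : lseries R).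
Proof. exact: deg_le_mono. Qed.

Lemma monoD c d i : mono (c + d) i = mono c i + mono d i :> lseries R.
Proof.
by apply: lseriesP => k; rewrite lcoefD !lcoef_mono; case: eqP; rewrite ?addr0.
Qed.

Lemma lcoef_exp F n : F ^+ n = sexp F n :> (int -> R).
Proof.
elim: n => [|n IH]; first by apply/funext => k; rewrite lcoef1.
by rewrite exprS lcoefM IH.
Qed.

Lemma deg_leX n F : deg_le (-1) F -> deg_le (- n%:Z) (F ^+ n).
Proof.
move=> F1; elim: n => [|n IH]; first exact: deg_le1.
rewrite exprS; apply: deg_le_trans (deg_leM F1 IH); lia.
Qed.

(** [F] is w^i plus lower powers of w; these series are invertible, and they
    are the ones that can be substituted when [i] is 1. *)
Definition monic_at i F := deg_le (i - 1) (F - mono 1 i).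

Lemma monic_at_deg_le i F : monic_at i F -> deg_le i F.
Proof.
move=> Fi; rewrite -(subrK (mono 1 i) F); apply: deg_leD; last exact: deg_le_mono.
by apply: deg_le_trans Fi; lia.
Qed.

Lemma monic_at_lead i F : monic_at i F -> F i = 1.
Proof.
move=> /(_ i); rewrite lcoefB lcoef_mono eqxx => h.
by apply/eqP; rewrite -subr_eq0 h//; lia.
Qed.

Lemma monic_at_mono i : monic_at i (mono 1 i).
Proof. by rewrite /monic_at subrr => k _; rewrite lcoef0. Qed.

Lemma monic_atM i j F G : monic_at i F -> monic_at j G -> monic_at (i + j) (F * G).
Proof.
move=> Fi Gj; rewrite /monic_at.
have -> : F * G - mono 1 (i + j) =
    (F - mono 1 i) * G + mono 1 i * (G - mono 1 j).
  by rewrite mulrBl mulrBr monoM mulr1 addrA subrK.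
apply: deg_leD.
  by apply: deg_le_trans (deg_leM Fi (monic_at_deg_le Gj)); lia.
by apply: deg_le_trans (deg_leM (@deg_le_mono _ 1 i) Gj); lia.
Qed.

Lemma monic_atX n i F : monic_at i F -> monic_at (i * n%:Z) (F ^+ n).
Proof.
move=> Fi; elim: n => [|n IH]; first by rewrite mulr0; exact: monic_at_mono.
rewrite exprS; have -> : i * n.+1%:Z = i + i * n%:Z by lia.
exact: monic_atM.
Qed.

Lemma fsum_nat (V : nmodType) (f : nat -> V) n :
  (forall j, (n <= j)%N -> f j = 0) ->
  \sum_(j \in [set: nat]) f j = \sum_(j < n) f j.
Proof.
move=> fn; rewrite (fsbigE (iota 0 n)) ?iota_uniq//=; last first.
  by move=> j _; rewrite mem_iota => h; apply: fn; lia.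
rewrite -(big_mkord xpredT) /index_iota subn0.
by apply: eq_bigl => i; rewrite in_setT.
Qed.

Definition geometric F : lseries R :=
  to_lseries (fun k => \sum_(j \in [set: nat]) (F ^+ j) k).

Lemma lcoef_geometric F k : deg_le (-1) F ->
  geometric F k = \sum_(j \in [set: nat]) (F ^+ j) k.
Proof.
move=> F1; rewrite (@to_lseriesE _ _ 0)// => {}k k0; apply: fsbig1 => j _.
by apply: (deg_leX F1); lia.
Qed.

(** Since [F] starts at w^(-1), its powers from the [n]-th on only reach
    exponents at most [- n]. *)
Lemma geometric_trunc n F : deg_le (-1) F ->
  deg_le (- n%:Z) (geometric F - \sum_(j < n) F ^+ j).
Proof.
move=> F1 k nk.
rewrite lcoefB lcoef_sum lcoef_geometric// (@fsum_nat _ _ n) ?subrr//.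
by move=> j nj; apply: (deg_leX F1); lia.
Qed.

(** A given coefficient only involves finitely many terms, for which the
    telescoping sum applies. *)
Lemma geometricP F : deg_le (-1) F -> geometric F * (1 - F) = 1.
Proof.
move=> F1; apply: lseriesP => k; apply/eqP; rewrite -subr_eq0 -lcoefB; apply/eqP.
pose n := `|k|.+1.
have -> : geometric F * (1 - F) - 1 =
    (geometric F - \sum_(j < n) F ^+ j) * (1 - F) - F ^+ n.
  rewrite mulrBl.
  have -> : (\sum_(j < n) F ^+ j) * (1 - F) = 1 - F ^+ n.
    by rewrite -[1 - F]opprB mulrN mulrC -subrX1 opprB.
  ring.
apply: (@deg_leB _ (- n%:Z)) => //; [|exact: deg_leX|by rewrite /n; lia].
rewrite -[X in deg_le X _]addr0; apply: deg_leM; first exact: geometric_trunc.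
apply: deg_leB; [exact: deg_le1|]; apply: deg_le_trans F1; lia.
Qed.

Lemma mono1_unit i : (mono 1 i : lseries R) * mono 1 (- i) = 1.
Proof. by rewrite monoM mulr1 subrr. Qed.

Lemma monic_at_rest i F : monic_at i F -> deg_le (-1) (1 - mono 1 (- i) * F).
Proof.
move=> Fi; rewrite -(mono1_unit (- i)) opprK -mulrBr -opprB mulrN.
by apply: deg_leN; apply: deg_le_trans (deg_leM (@deg_le_mono _ 1 (- i)) Fi); lia.
Qed.

(** F = w^i (1 - r) with r = 1 - w^(-i) F of negative exponents, and
    1 / (1 - r) is a geometric series. *)
Lemma monic_at_geometric i F : monic_at i F ->
  mono 1 (- i) * geometric (1 - mono 1 (- i) * F) * F = 1.
Proof.
by move=> /monic_at_rest/geometricP; rewrite subKr -mulrA mulrCA.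
Qed.

Lemma monic_at_unit i F : monic_at i F -> F \is a GRing.unit.
Proof. by move=> /monic_at_geometric/lseries_unitP. Qed.

Lemma monic_atV_geometric i F : monic_at i F ->
  F^-1 = mono 1 (- i) * geometric (1 - mono 1 (- i) * F).
Proof.
move=> Fi; have uF := monic_at_unit Fi.
by apply: (mulIr uF); rewrite mulVr// monic_at_geometric.
Qed.

Lemma monic_atV i F : monic_at i F -> monic_at (- i) F^-1.
Proof.
move=> Fi; rewrite (monic_atV_geometric Fi).
rewrite -[X in monic_at X]addr0; apply: monic_atM; first exact: monic_at_mono.
have := @geometric_trunc 1 _ (monic_at_rest Fi).
by rewrite big_ord1 expr0 /monic_at sub0r.
Qed.

Lemma monic_at_exprz (i : int) F : monic_at 1 F -> monic_at i (F ^ i).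
Proof.
case: i => n F1; first by rewrite -exprnP -[X in monic_at X]mul1r; exact: monic_atX.
have -> : Negz n = - (1 * n.+1%:Z) by rewrite mul1r NegzE.
rewrite mul1r -exprnN; apply: monic_atV.
by rewrite -[X in monic_at X]mul1r; exact: monic_atX.
Qed.

(** * Derivation and composition *)
Definition lderiv F : lseries R := to_lseries (sderiv F).
Local Notation D := lderiv.

Lemma deg_le_sderiv N (f : int -> R) : deg_le N f -> deg_le (N - 1) (sderiv f).
Proof. by move=> fN k Nk; rewrite /sderiv fN ?mul0rz//; lia. Qed.

Lemma lcoef_lderiv F : D F = sderiv F :> (int -> R).
Proof.
by have [N FN] := lseries_bounded F; apply: to_lseriesE (deg_le_sderiv FN).
Qed.

Lemma deg_le_lderiv N F : deg_le N F -> deg_le (N - 1) (D F).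
Proof. by rewrite lcoef_lderiv; exact: deg_le_sderiv. Qed.

Lemma lderivD : {morph D : F G / F + G}.
Proof.
move=> F G; apply: lseriesP => k.
by rewrite lcoefD !lcoef_lderiv /sderiv lcoefD mulrzDl.
Qed.

Lemma lderivB : {morph D : F G / F - G}.
Proof.
move=> F G; apply: lseriesP => k.
by rewrite lcoefB !lcoef_lderiv /sderiv lcoefB mulrzBl.
Qed.

Lemma lderiv_mono c i : D (mono c i) = mono (c *~ i) (i - 1).
Proof.
apply: lseriesP => k; rewrite lcoef_lderiv /sderiv !lcoef_mono.
have -> : (k == i - 1) = (k + 1 == i) by lia.
by case: eqP => [->|]; rewrite ?mul0rz.
Qed.

Lemma bounded_shift_lderiv : bounded_shift D.
Proof. by exists (-1) => N F; exact: deg_le_lderiv. Qed.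

Lemma bounded_shiftMl F : bounded_shift ( *%R F).
Proof. exact: bounded_shift_mull. Qed.

Lemma bounded_shiftMr F : bounded_shift ( *%R^~ F).
Proof. exact: bounded_shift_mulr. Qed.

Lemma lderivM F G : D (F * G) = D F * G + F * D G.
Proof.
apply: (@operator_eq_on_mono _ (fun F => D (F * G)) (fun F => D F * G + F * D G)).
- by move=> F1 F2; rewrite mulrDl lderivD.
- by move=> F1 F2; rewrite lderivD; ring.
- exact: bounded_shift_comp bounded_shift_lderiv (bounded_shiftMr _).
- apply: bounded_shiftD (bounded_shiftMr _).
  exact: bounded_shift_comp (bounded_shiftMr _) bounded_shift_lderiv.
move=> c i.
apply: (@operator_eq_on_mono _ (fun G => D (mono c i * G))
  (fun G => D (mono c i) * G + mono c i * D G)).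
- by move=> F1 F2; rewrite mulrDr lderivD.
- by move=> F1 F2; rewrite lderivD; ring.
- exact: bounded_shift_comp bounded_shift_lderiv (bounded_shiftMl _).
- apply: bounded_shiftD; first exact: bounded_shiftMl.
  exact: bounded_shift_comp (bounded_shiftMl _) bounded_shift_lderiv.
move=> d j; rewrite !(monoM, lderiv_mono).
have -> : i - 1 + j = i + j - 1 by lia.
rewrite addrA -monoD; congr mono.
by rewrite mulrzDr mulrzAl mulrzAr.
Qed.

(** Induction in both directions: the Leibniz rule for F^j = F^(j-1) F relates
    the formulas for consecutive exponents. *)
Lemma lderiv_exprz F (i : int) : F \is a GRing.unit ->
  D (F ^ i) = (F ^ (i - 1) * D F) *~ i.
Proof.
move=> uF; have step (j : int) : F ^ (j + 1) = F ^ j * F by rewrite exprzDr ?expr1z.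
have prev (j : int) : F ^ j = F ^ (j - 1) * F by rewrite -step subrK.
elim/int_rec: i => [|n IH|n IH].
- rewrite expr0z mulr0z lderiv_mono mulr0z.
  by apply: lseriesP => k; rewrite lcoef_mono lcoef0 if_same.
- have -> : n.+1%:Z = n%:Z + 1 by lia.
  by rewrite step lderivM IH addrK -mulrzr -[RHS]mulrzr rmorphD/= (prev n%:Z); ring.
- have -> : - n.+1%:Z = - n%:Z - 1 by lia.
  move: (- n%:Z) IH => j IH; apply: (mulIr uF).
  have -> : D (F ^ (j - 1)) * F = D (F ^ j) - F ^ (j - 1) * D F.
    by rewrite [in RHS]prev lderivM addrK.
  by rewrite IH -mulrzr -[X in _ = X * _]mulrzr rmorphB/= (prev (j - 1)); ring.
Qed.

Definition lcomp F G : lseries R :=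
  to_lseries (fun k => \sum_(i \in [set: int]) F i * (G ^ i) k).

Lemma deg_le_lcomp_fun N F G : monic_at 1 G -> deg_le N F ->
  deg_le N (fun k => \sum_(i \in [set: int]) F i * (G ^ i) k).
Proof.
move=> G1 FN k Nk; apply: fsbig1 => i _.
have [iN|/FN ->] := leP i N; last by rewrite mul0r.
by rewrite (monic_at_deg_le (@monic_at_exprz i _ G1)) ?mulr0//; lia.
Qed.

Lemma lcoef_lcomp F G k : monic_at 1 G ->
  lcomp F G k = \sum_(i \in [set: int]) F i * (G ^ i) k.
Proof.
have [N FN] := lseries_bounded F.
by move=> G1; rewrite /lcomp (to_lseriesE (deg_le_lcomp_fun G1 FN)).
Qed.

Lemma deg_le_lcomp N F G : monic_at 1 G -> deg_le N F -> deg_le N (lcomp F G).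
Proof.
by move=> G1 FN k Nk; rewrite lcoef_lcomp//; exact: deg_le_lcomp_fun FN _ Nk.
Qed.

Lemma lcomp_window N F G a b k : monic_at 1 G -> deg_le N F -> a <= k -> N <= b ->
  lcomp F G k = \sum_(i <- zrange a b) F i * (G ^ i) k.
Proof.
move=> G1 FN ak Nb; rewrite lcoef_lcomp//; apply: fsum_zrange => i.
apply: contraR => out; have [iN|/FN ->] := leP i N; last by rewrite mul0r.
by rewrite (monic_at_deg_le (@monic_at_exprz i _ G1)) ?mulr0//; lia.
Qed.

Lemma lcompD G : monic_at 1 G -> {morph lcomp^~ G : E F / E + F}.
Proof.
move=> G1 E F; apply: lseriesP => k; have [N [EN FN]] := lseries_bounded2 E F.
rewrite lcoefD !(@lcomp_window N _ G k N)//; last exact: deg_leD.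
by rewrite -big_split; apply: eq_bigr => i _; rewrite lcoefD mulrDl.
Qed.

Lemma lcomp_mono c i G : monic_at 1 G -> lcomp (mono c i) G = mono c 0 * G ^ i.
Proof.
move=> G1; apply: lseriesP => k; rewrite lcoef_lcomp// lcoef_monoM subr0.
rewrite (@fsum_zrange _ _ i i) => [|j]; last first.
  by rewrite lcoef_mono; case: (j =P i) => [->|]; rewrite ?lexx// mul0r eqxx.
by rewrite /zrange subrr/= big_seq1 lcoef_mono addr0 eqxx.
Qed.

Lemma bounded_shift_lcomp G : monic_at 1 G -> bounded_shift (lcomp^~ G).
Proof. by move=> G1; exists 0 => N F FN; rewrite addr0; exact: deg_le_lcomp. Qed.

(** On monomials this is the rule for adding exponents of powers of [G]. *)
Lemma lcompM E F G : monic_at 1 G -> lcomp (E * F) G = lcomp E G * lcomp F G.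
Proof.
move=> G1; have uG := monic_at_unit G1; have cG := bounded_shift_lcomp G1.
have [Ml Mr] := (bounded_shiftMl, bounded_shiftMr).
apply: (@operator_eq_on_mono _ (fun E => lcomp (E * F) G)
  (fun E => lcomp E G * lcomp F G)).
- by move=> E1 E2; rewrite mulrDl lcompD.
- by move=> E1 E2; rewrite lcompD// mulrDl.
- exact: bounded_shift_comp cG (Mr _).
- exact: bounded_shift_comp (Mr _) cG.
move=> c i.
apply: (@operator_eq_on_mono _ (fun F => lcomp (mono c i * F) G)
  (fun F => lcomp (mono c i) G * lcomp F G)).
- by move=> E1 E2; rewrite mulrDr lcompD.
- by move=> E1 E2; rewrite lcompD// mulrDr.
- exact: bounded_shift_comp cG (Ml _).
- exact: bounded_shift_comp (Ml _) cG.
move=> d j; rewrite monoM !lcomp_mono// exprzDr//.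
have -> : mono (c * d) 0 = mono c 0 * mono d 0 :> lseries R by rewrite monoM.
by ring.
Qed.

(** Both sides are the geometric series, the left one by definition. *)
Lemma sinvE F : monic_at 1 F -> sinv F = F^-1 :> (int -> R).
Proof.
move=> F1; set y := 1 - mono 1 (-1) * F.
have y1 : deg_le (-1) y := monic_at_rest F1.
rewrite (monic_atV_geometric F1) -/y.
have mE (c : R) i : mono c i = (fun k => if k == i then c else 0) :> (int -> R).
  by apply/funext => k; rewrite lcoef_mono.
have sE i : smono i = (mono 1 i : lseries R) :> (int -> R).
  by apply/funext => k; rewrite mE /smono; case: eqP.
rewrite lcoefM /sinv !sE; congr smul; apply/funext => k.
rewrite lcoef_geometric//; apply: eq_fsbigr => j _; rewrite lcoef_exp -lcoefM.
by congr (sexp _ j k); apply/funext => i; rewrite lcoefB.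
Qed.

Lemma lcoef_exprz F i : monic_at 1 F -> F ^ i = sexpz F i :> (int -> R).
Proof.
move=> F1; case: i => n; first exact: lcoef_exp.
by rewrite NegzE -exprnN -exprVn lcoef_exp -sinvE.
Qed.

Lemma scompE F G : monic_at 1 G -> scomp F G = lcomp F G :> (int -> R).
Proof.
move=> G1; apply/funext => k; rewrite lcoef_lcomp//.
by apply: eq_fsbigr => i _; rewrite lcoef_exprz.
Qed.

Lemma deg_le_wseries (a : nat -> R) : deg_le 1 (wseries a).
Proof. by case=> // -[|[|]]. Qed.

Definition wlseries (a : nat -> R) : lseries R := to_lseries (wseries a).

Lemma lcoef_wlseries a : wlseries a = wseries a :> (int -> R).
Proof. exact: to_lseriesE (@deg_le_wseries a). Qed.

(** One exponent better than being monic: there is no constant term. *)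
Lemma wlseries_rest a : deg_le (-1) (wlseries a - mono 1 1).
Proof.
move=> k k0; rewrite lcoefB lcoef_wlseries lcoef_mono.
by case: k k0 => // -[|[|n]] _; rewrite /= ?subrr.
Qed.

Lemma wlseries_monic a : monic_at 1 (wlseries a).
Proof. by apply: deg_le_trans (@wlseries_rest a). Qed.

End SeriesTheory.

(** * Maps acting on coefficients *)
Lemma lcoef_signM (R : comNzRingType) (F : lseries R) n k :
  ((-1) ^+ n * F) k = (-1) ^+ n * F k.
Proof.
by elim: n => [|n IH]; rewrite ?expr0 ?mul1r// !exprS -!mulrA !mulN1r lcoefN IH.
Qed.

Section CoefficientMap.
Variables R S : comNzRingType.

Definition map_lseries (f : R -> S) (F : lseries R) : lseries S :=
  to_lseries (fun k => f (F k)).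

Lemma lcoef_map (f : {additive R -> S}) F k : map_lseries f F k = f (F k).
Proof.
have [N FN] := lseries_bounded F.
by rewrite (@to_lseriesE _ _ N)// => l Nl; rewrite FN// raddf0.
Qed.

Lemma map_mono (f : {additive R -> S}) c i :
  map_lseries f (mono c i) = mono (f c) i.
Proof.
by apply: lseriesP => k; rewrite lcoef_map !lcoef_mono; case: eqP; rewrite ?raddf0.
Qed.

Lemma map_lseriesM (f : {rmorphism R -> S}) (F G : lseries R) :
  map_lseries f (F * G) = map_lseries f F * map_lseries f G.
Proof.
apply: lseriesP => k; have [N [FN GN]] := lseries_bounded2 F G.
have mN (H : lseries R) : deg_le N H -> deg_le N (map_lseries f H).
  by move=> HN l Nl; rewrite lcoef_map HN// raddf0.
rewrite lcoef_map !lcoefM !(@smul_window _ N N k (k - N) N)//; [|exact: mN..].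
rewrite raddf_sum; apply: eq_bigr => i _; rewrite !lcoef_map; exact: rmorphM.
Qed.

Lemma map_lseriesX (f : {rmorphism R -> S}) (F : lseries R) n :
  map_lseries f (F ^+ n) = map_lseries f F ^+ n.
Proof.
elim: n => [|n IH]; first by rewrite !expr0 map_mono; congr mono; exact: rmorph1.
by rewrite !exprS map_lseriesM IH.
Qed.

End CoefficientMap.

Section CoefficientDerivation.
Variable R : comNzRingType.
Local Notation dw := (map_lseries (@deriv R)).

Lemma coefwise_derivM (F G : lseries {poly R}) : dw (F * G) = dw F * G + F * dw G.
Proof.
apply: lseriesP => k; have [N [FN GN]] := lseries_bounded2 F G.
have dN (H : lseries {poly R}) : deg_le N H -> deg_le N (dw H).
  by move=> HN l Nl; rewrite lcoef_map HN// raddf0.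
rewrite lcoef_map lcoefD !lcoefM !(@smul_window _ N N k (k - N) N)//; [|exact: dN..].
rewrite raddf_sum -big_split; apply: eq_bigr => i _ /=.
by rewrite !lcoef_map derivM.
Qed.

Lemma coefwise_derivX (F : lseries {poly R}) n :
  dw (F ^+ n.+1) = (F ^+ n * dw F) *+ n.+1.
Proof.
elim: n => [|n IH]; first by rewrite expr1 expr0 mul1r.
by rewrite exprS coefwise_derivM IH mulrnAr mulrA -exprS mulrC [RHS]mulrS.
Qed.

End CoefficientDerivation.

(** * Residues *)
Section Residue.
Variable K : numFieldType.
Implicit Types F G L : lseries K.
Local Notation D := lderiv.

Lemma residue_deriv F : D F (-1) = 0.
Proof. by rewrite lcoef_lderiv /sderiv addNr mulr0z. Qed.

Lemma monic_at_deriv L : monic_at 1 L -> monic_at 0 (D L).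
Proof.
move=> L1; rewrite /monic_at; have -> : mono 1 0 = D (mono 1 1) :> lseries K.
  by rewrite lderiv_mono mulr1z subrr.
by rewrite -lderivB; apply: deg_le_trans (deg_le_lderiv L1).
Qed.

(** Change of variables in a residue.  For G = z^i with i different from -1 the
    left-hand side is the residue of the exact derivative of L^(i+1) / (i+1);
    for i = -1 it is the logarithmic derivative of [L], whose leading term is
    w^(-1). *)
Lemma residue_comp G L : monic_at 1 L -> (lcomp G L * D L) (-1) = G (-1).
Proof.
move=> L1; have DL := monic_at_deriv L1.
apply: (@additive_eq_on_mono _ _ (fun G => (lcomp G L * D L) (-1))
  (fun G => G (-1)) (-2)).
- by move=> E F; rewrite lcompD// mulrDl lcoefD.
- by move=> E F; rewrite lcoefD.
- move=> F F2; apply: (deg_leM (deg_le_lcomp L1 F2) (monic_at_deg_le DL)); lia.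
- by move=> F F2; apply: F2; lia.
move=> c i; rewrite lcomp_mono// -mulrA lcoef_monoM subr0 lcoef_mono.
case: eqP => [<-|i1].
  by rewrite (monic_at_lead (monic_atM (@monic_at_exprz _ (-1) _ L1) DL)) mulr1.
suff -> : (L ^ i * D L) (-1) = 0 by rewrite mulr0.
have := residue_deriv (L ^ (i + 1)).
rewrite lderiv_exprz ?(monic_at_unit L1)// addrK lcoefMz => /eqP.
by rewrite mulrz_eq0 => /orP[/eqP|/eqP//]; lia.
Qed.

Definition nneg F : lseries K := to_lseries (snneg F).

Lemma deg_le_snneg N (f : int -> K) : deg_le N f -> deg_le N (snneg f).
Proof. by move=> fN k Nk; rewrite /snneg fN// if_same. Qed.

Lemma lcoef_nneg F : nneg F = snneg F :> (int -> K).
Proof.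
by have [N FN] := lseries_bounded F; exact: to_lseriesE (deg_le_snneg FN).
Qed.

Lemma deg_le_sub_nneg F : deg_le (-1) (F - nneg F).
Proof.
move=> k k0; rewrite lcoefB lcoef_nneg /snneg ifT ?subrr//; lia.
Qed.

(** The negative part of [F] has a derivative of exponents at most -2, and its
    product with [G] cannot reach w^(-1). *)
Lemma residue_nneg_deriv F G : deg_le (-1) G ->
  (D F * G) (-1) = (D (nneg F) * G) (-1).
Proof.
move=> G1; apply/eqP; rewrite -subr_eq0 -lcoefB -mulrBl -lderivB.
by rewrite (deg_leM (deg_le_lderiv (@deg_le_sub_nneg F)) G1)//; lia.
Qed.

Definition wsub (U : K) : lseries K := mono 1 1 - mono U 0.

Lemma monic_at_sub_const F U : monic_at 1 F -> monic_at 1 (F - mono U 0).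
Proof.
by move=> F1; rewrite /monic_at addrAC; apply: deg_leB F1 (@deg_le_mono _ _ _).
Qed.

Lemma monic_at_wsub U : monic_at 1 (wsub U).
Proof. exact/monic_at_sub_const/monic_at_mono. Qed.

Lemma inv_sub_wE U : inv_sub_w U = - (wsub U)^-1 :> (int -> K).
Proof.
have TN : deg_le (-1) (inv_sub_w U) by case=> // -[].
rewrite -(to_lseriesE TN); congr lcoef; set T := to_lseries _.
have TE : T = inv_sub_w U :> (int -> K) := to_lseriesE TN.
have uU := monic_at_unit (monic_at_wsub U).
apply: (mulIr uU); rewrite mulNr mulVr//.
apply: lseriesP => k; rewrite mulrC mulrBl lcoefB !lcoef_monoM lcoefN lcoef1 TE.
case: k => [[|k]|k].
- by rewrite /= ?mulr0 ?subr0 ?expr0 ?mul1r ?eqxx; ring.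
- have -> : k.+1%:Z - 1 = k by lia.
  by rewrite /= !mulr0 subr0 oppr0.
have -> : Negz k - 1 = Negz k.+1 by lia.
have -> : Negz k - 0 = Negz k by lia.
by rewrite /= exprS; ring.
Qed.

End Residue.

(** * Derivatives of Faber polynomials *)
Section FaberDerivative.
Variable K : numFieldType.
Variable kap : lseries K.
Local Notation dw := (map_lseries (@deriv K)).

Definition faber_series : lseries {poly K} :=
  mono 1 (-1) * (map_lseries (@polyC K) kap - mono 'X 0).

Lemma lcoef_faber_series k :
  faber_series k = (kap (k + 1))%:P - (if k == -1 then 'X else 0).
Proof.
rewrite lcoef_monoM mul1r opprK lcoefB lcoef_map lcoef_mono.
by have -> : (k + 1 == 0) = (k == -1) by lia.
Qed.

Lemma faber_arg_series : faber_arg kap = faber_series :> (int -> {poly K}).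
Proof.
rewrite lcoefM /faber_arg; congr smul; apply/funext => k.
  by rewrite lcoef_mono /smono; case: eqP.
rewrite lcoefB lcoef_map lcoef_mono /smono.
by case: eqP; rewrite ?mulr1 ?mulr0.
Qed.

Lemma faber_series_monic : monic_at 1 kap -> monic_at 0 faber_series.
Proof.
move=> k1; suff: monic_at (-1 + 1) faber_series by rewrite addNr.
apply: monic_atM; first exact: monic_at_mono.
rewrite /monic_at addrAC; apply: deg_leB; last exact: deg_le_mono.
move=> k k0.
have := k1 k k0; rewrite !lcoefB lcoef_map !lcoef_mono /=.
by case: (k == 1); rewrite -?polyC1 -polyC0 -polyCB => ->.
Qed.

Lemma coefwise_deriv_faber_series : dw (faber_series - 1) = mono (-1) (-1).
Proof.
apply: lseriesP => k; rewrite lcoef_map lcoefB lcoef1 lcoef_faber_series lcoef_mono.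
rewrite /= !derivB derivC.
by case: (k == -1); case: (k == 0); rewrite /= ?derivX ?derivC ?deriv0 ?derivC; ring.
Qed.

Lemma eval_faber_series (U : K) :
  map_lseries (horner_eval U) (faber_series - 1) =
    mono 1 (-1) * (kap - mono U 0) - 1.
Proof.
apply: lseriesP => k.
rewrite lcoef_map !lcoefB lcoef_monoM lcoefB !lcoef1 lcoef_faber_series.
rewrite lcoef_mono opprK /= /horner_eval !hornerE.
have -> : (k + 1 == 0) = (k == -1) by lia.
by case: (k == -1); case: (k == 0); rewrite /= !hornerE; ring.
Qed.

(** Let x = (k(z) - w) / z - 1.  Its w-derivative is - z^(-1), so the derivative
    of the logarithmic series is - z^(-1) times the geometric series of - x.
    At w = U the latter sums to z / (k(z) - U). *)
Lemma faber_deriv_horner (U : K) n : monic_at 1 kap ->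
  (faber kap n)^`().[U] = n%:R * (kap - mono U 0)^-1 (- n%:Z).
Proof.
move=> k1; set x := faber_series - 1.
have x1 : deg_le (-1) x := faber_series_monic k1.
set y := map_lseries (horner_eval U) x.
have y1 : deg_le (-1) y by move=> k kN; rewrite lcoef_map x1// raddf0.
have faberE : faber kap n =
   - (n%:R *: \sum_(j < n) ((-1) ^+ j / j.+1%:R) *: (x ^+ j.+1) (- n%:Z)).
  rewrite /faber /slog faber_arg_series.
  have -> : ssub faber_series (smono 0) = x.
    by apply/funext => k; rewrite lcoefB lcoef1.
  rewrite (@fsum_nat _ _ n) => [|j nj]; last first.
    by rewrite -lcoef_exp (deg_leX x1) ?scaler0//; lia.
  by congr (- (_ *: _)); apply: eq_bigr => j _; rewrite lcoef_exp.
have term (j : 'I_n) : ((x ^+ j.+1) (- n%:Z))^`().[U] =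
    - (y ^+ j) (1 - n%:Z) *+ j.+1.
  rewrite -(lcoef_map (@deriv K)) coefwise_derivX coefwise_deriv_faber_series.
  rewrite lcoefMn hornerMn.
  rewrite mulrC lcoef_monoM mulN1r hornerN opprK [- n%:Z + 1]addrC.
  by rewrite -map_lseriesX lcoef_map.
rewrite faberE derivN derivZ hornerN hornerZ -mulrN; congr (_ * _).
rewrite raddf_sum horner_sum -sumrN /=.
transitivity ((\sum_(j < n) (- y) ^+ j) (1 - n%:Z)).
  rewrite lcoef_sum; apply: eq_bigr => j _.
  rewrite derivZ hornerZ term [(- y) ^+ _]exprNn.
  rewrite lcoef_signM -mulr_natr.
  have j0 : j.+1%:R != 0 :> K by rewrite pnatr_eq0.
  by field.
have ny1 : deg_le (-1) (- y) by exact: deg_leN.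
have := @geometric_trunc _ n _ ny1 (1 - n%:Z).
rewrite lcoefB => /(_ _)/eqP; rewrite subr_eq0 => /(_ _)/eqP <-; last lia.
have kU := monic_at_sub_const U k1.
suff -> : geometric (- y) = mono 1 1 * (kap - mono U 0)^-1.
  by rewrite lcoef_monoM mul1r; congr lcoef; lia.
apply: (mulIr (monic_at_unit kU)); rewrite mulrVK ?(monic_at_unit kU)//.
have yE : 1 + y = mono 1 (-1) * (kap - mono U 0).
  by rewrite /y eval_faber_series addrC subrK.
have := geometricP ny1; rewrite opprK yE => gE.
rewrite -[RHS]mulr1 -gE -[LHS]mul1r -(@mono1_unit _ 1).
ring.
Qed.

End FaberDerivative.

Section FaberResidue.
Variable K : numFieldType.
Implicit Types L kap : lseries K.
Local Notation D := lderiv.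

(** The series G(z) = z^(n-1) / (k(z) - U) becomes L^(n-1) / (w - U) under
    z = L(w), because k(L(w)) = w; and n L^(n-1) L' is (L^n)'. *)
Lemma faber_deriv_residue L kap (U : K) n :
    monic_at 1 L -> monic_at 1 kap -> lcomp kap L = mono 1 1 ->
  (faber kap n)^`().[U] = (D (nneg (L ^+ n)) * (wsub U)^-1) (-1).
Proof.
move=> L1 k1 kL; have kU := monic_at_sub_const U k1.
have wU := monic_at_wsub U.
rewrite -residue_nneg_deriv; last exact: monic_at_deg_le (monic_atV wU).
(* G(z) = z^(n-1) / (k(z) - U), whose residue is [z^(-n)] 1 / (k(z) - U) *)
pose G := mono 1 (n%:Z - 1) * (kap - mono U 0)^-1.
have -> : L ^+ n = L ^ n by [].
rewrite lderiv_exprz ?(monic_at_unit L1)// faber_deriv_horner//.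
have -> : (kap - mono U 0)^-1 (- n%:Z) = G (-1).
  by rewrite /G lcoef_monoM mul1r; congr lcoef; lia.
rewrite -(residue_comp G L1) lcompM// lcomp_mono//.
have -> : lcomp (kap - mono U 0)^-1 L = (wsub U)^-1.
  apply: (mulIr (monic_at_unit wU)); rewrite mulVr ?(monic_at_unit wU)//.
  have {1}-> : wsub U = lcomp (kap - mono U 0) L.
    rewrite -[RHS](addrK (lcomp (mono U 0) L)) -lcompD// subrK kL.
    by rewrite lcomp_mono// expr0z mulr1.
  rewrite -lcompM// mulVr ?(monic_at_unit kU)// lcomp_mono// expr0z mulr1//.
have -> : (mono 1 0 : lseries K) = 1 by [].
by rewrite mul1r mulrzAl lcoefMz -mulrzl mulrAC.
Qed.

End FaberResidue.

(** * The dKP flows reduced to one variable *)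
Section ReducedFlows.
Variable K : numFieldType.
Implicit Types (L Ld q : lseries K).
Local Notation D := lderiv.

Definition nonneg q := forall k, k < 0 -> q k = 0.

(** The n-th flow after reduction to one variable: [x] and [y] stand for the
    derivatives of lambda along t_n and t_1, [Ld] for the lambda-derivative of
    [L], and [q] for the x-derivative of (L^n)_{>= 0}. *)
Definition reduced_flow L Ld n (x y : K) := exists2 q, nonneg q &
  mono x 0 * Ld = mono y 0 * (D (nneg (L ^+ n)) * Ld) - q * D L.

Lemma monic_at_normalized L : deg_le (-1) (L - mono 1 1) -> monic_at 1 L.
Proof. exact: deg_le_trans. Qed.

Lemma nonneg_deg_le_eq0 q : nonneg q -> deg_le (-1) q -> q = 0.
Proof.
move=> q0 q1; apply: lseriesP => k; rewrite lcoef0.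
by have [/q0|k0] := ltP k 0; last by apply: q1; lia.
Qed.

(** Here -q = x Ld / L', whose exponents are negative, so [q] vanishes. *)
Lemma reduced_flow_stationary L Ld n x :
    deg_le (-1) (L - mono 1 1) -> deg_le (-1) Ld ->
  reduced_flow L Ld n x 0 -> mono x 0 * Ld = 0.
Proof.
move=> L1 Ld1 [q q0]; have DL := monic_at_deriv (monic_at_normalized L1).
have -> : mono 0 0 = 0 :> lseries K by [].
rewrite mul0r add0r => e.
suff qE : q = 0 by rewrite e qE mul0r oppr0.
apply: nonneg_deg_le_eq0 => //.
have -> : q = - (mono x 0 * Ld) * (D L)^-1.
  by rewrite e opprK mulrK ?(monic_at_unit DL).
rewrite -[X in deg_le X _]addr0 -oppr0; apply: deg_leM; last first.
  exact: monic_at_deg_le (monic_atV DL).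
apply: deg_leN; rewrite -[X in deg_le X _]add0r; apply: deg_leM => //.
exact: deg_le_mono.
Qed.

Lemma lderiv_nneg_sqr L : deg_le (-1) (L - mono 1 1) ->
  D (nneg (L ^+ 2)) = mono 2 1.
Proof.
move=> L1; set r := L - mono 1 1.
have -> : L = mono 1 1 + r by rewrite addrC subrK.
have mr : deg_le 0 (mono 1 1 * r) := deg_leM (@deg_le_mono _ 1 1) L1.
have X0 : deg_le 0 (mono 1 1 * r *+ 2 + r ^+ 2).
  apply: deg_leD; last by apply: deg_le_trans (deg_leM L1 L1).
  by rewrite mulr2n; exact: deg_leD.
have -> : (mono 1 1 + r) ^+ 2 = mono 1 2 + (mono 1 1 * r *+ 2 + r ^+ 2).
  by rewrite sqrrD -addrA expr2 monoM mulr1.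
apply: lseriesP => k.
rewrite lcoef_lderiv /sderiv lcoef_nneg /snneg lcoefD !lcoef_mono.
have [k0|k0] := boolP (0 <= k + 1); last first.
  by rewrite mul0rz; case: eqP => //; lia.
have [k1|k1] := ltP 0 (k + 1).
  rewrite X0// addr0.
  have -> : (k + 1 == 2) = (k == 1) by lia.
  by case: eqP => [->|]; rewrite ?mul0rz.
have -> : k + 1 = 0 by lia.
by rewrite mulr0z; case: eqP => //; lia.
Qed.

(** The polynomial q = (2 y w - x) Ld / L' is O(1), hence constant, and its value
    is read off the leading coefficients. *)
Lemma second_flow_loewner L Ld x y :
    deg_le (-1) (L - mono 1 1) -> deg_le (-1) Ld -> y != 0 ->
    reduced_flow L Ld 2 x y ->
  wsub (x / (2 * y)) * Ld = mono (Ld (-1)) 0 * D L.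
Proof.
move=> L1 Ld1 y0 [q q0]; have DL := monic_at_deriv (monic_at_normalized L1).
rewrite lderiv_nneg_sqr// => e.
have eq : q * D L = mono (2 * y) 0 * (wsub (x / (2 * y)) * Ld).
  have yx : mono x 0 = mono (2 * y) 0 * mono (x / (2 * y)) 0 :> lseries K.
    by rewrite monoM mulrC divfK ?mulf_neq0// pnatr_eq0.
  have y2 : mono (2 * y) 0 * mono 1 1 = mono y 0 * mono 2 1 :> lseries K.
    by rewrite !monoM mulr1 mulrC.
  rewrite /wsub mulrBl mulrBr !mulrA y2 -yx -[mono y 0 * _ * _]mulrA e; ring.
have wLd0 : deg_le 0 (wsub (x / (2 * y)) * Ld).
  by apply: (deg_leM (monic_at_deg_le (monic_at_wsub _)) Ld1).
have qE : q = mono (2 * y) 0 * (wsub (x / (2 * y)) * Ld) * (D L)^-1.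
  by rewrite -eq mulrK ?(monic_at_unit DL).
have q_le : deg_le 0 q.
  rewrite qE; rewrite -[X in deg_le X _]addr0 -oppr0.
  apply: deg_leM; last exact: monic_at_deg_le (monic_atV DL).
  rewrite -[X in deg_le X _]addr0; apply: deg_leM => //; exact: deg_le_mono.
have qc : q = mono (q 0) 0.
  apply: lseriesP => k; rewrite lcoef_mono; case: eqP => [->//|k0].
  by have [/q0|k1] := ltP k 0; last by apply: q_le; lia.
have y2 : 2 * y != 0 by rewrite mulf_neq0// pnatr_eq0.
have lead : q 0 = 2 * y * Ld (-1).
  have -> : q 0 = (q * D L) 0.
    by rewrite [in RHS]qc lcoef_monoM subr0 (monic_at_lead DL) mulr1.
  rewrite eq lcoef_monoM subr0 /wsub mulrBl lcoefB !lcoef_monoM mul1r subr0 sub0r.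
  by rewrite (Ld1 0)// mulr0 subr0.
have cancel_y : (mono (2 * y)^-1 0 : lseries K) * mono (2 * y) 0 = 1.
  by rewrite monoM mulVf.
have key : mono (2 * y) 0 * (wsub (x / (2 * y)) * Ld) =
    mono (2 * y) 0 * (mono (Ld (-1)) 0 * D L).
  by rewrite -eq {1}qc lead [RHS]mulrA monoM.
by rewrite -[LHS]mul1r -cancel_y -mulrA key mulrA cancel_y mul1r.
Qed.

(** Divide the flow by L' and take residues, which removes [q]. *)
Lemma reduced_flow_speed L Ld n x y c :
    deg_le (-1) (L - mono 1 1) -> Ld (-1) != 0 ->
    wsub c * Ld = mono (Ld (-1)) 0 * D L ->
    reduced_flow L Ld n x y ->
  x = y * (D (nneg (L ^+ n)) * (wsub c)^-1) (-1).
Proof.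
move=> L1 a0 loewner [q q0 e]; have DL := monic_at_deriv (monic_at_normalized L1).
have w1 := monic_at_wsub c; set S := (wsub c)^-1.
have LdE : Ld = mono (Ld (-1)) 0 * (S * D L).
  by rewrite mulrCA -loewner mulKr ?(monic_at_unit w1).
move: e; rewrite LdE; set a := Ld (-1); set B := D (nneg _) => e.
(* the flow divided by L' *)
have {}e : mono x 0 * (mono a 0 * S) = mono y 0 * (mono a 0 * (B * S)) - q.
  apply: (mulIr (monic_at_unit DL)); move: e; rewrite mulrBl !mulrA => ->; ring.
have := congr1 (fun F : lseries K => F (-1)) e.
rewrite lcoefB 4!lcoef_monoM !subr0 (q0 (-1))// subr0.
rewrite (monic_at_lead (monic_atV w1)) mulr1 [a * _]mulrC mulrA.
exact: mulIf.
Qed.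

End ReducedFlows.

(** * From the hierarchy to the reduced flows *)
Section Reduction.
Variable K : numFieldType.
Local Notation D := lderiv.

Lemma dt_comp (f : K -> K) (lam : times K -> K) n t :
    has_dt n lam t -> derivable f (lam t) 1 ->
  dt n (f \o lam) t = derive1 f (lam t) * dt n lam t.
Proof.
have slice_t : slice n lam t (t n.-1) = lam t.
  by rewrite /slice; congr lam; apply/funext => i /=; case: eqP => [->|].
rewrite /has_dt /dt -slice_t; set g := slice n lam t; set x := t _.
have -> : slice n (f \o lam) t = f \o g by [].
move=> /derivable1_diffP dg /derivable1_diffP df.
rewrite derive1E'; last exact/differentiable_comp.
rewrite diff_comp// !derive1E'//= -[X in 'd _ _ X = _]mulr1.
by rewrite [LHS]linearZ mulrC.
Qed.

Lemma dt_cst (h : times K -> K) n t c : (forall t', h t' = c) -> dt n h t = 0.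
Proof.
move=> hc; rewrite /dt (_ : slice n h t = cst c) ?derive1_cst//.
by apply/funext => s; rewrite /slice hc.
Qed.

Definition lax_series (u : nat -> K -> K) (l : K) : lseries K :=
  wlseries (fun n => u n.+1 l).

Definition lax_rate (u : nat -> K -> K) (l : K) : lseries K :=
  to_lseries (fun k => derive1 (fun l' => lax (u^~ l') k) l).

Lemma lcoef_lax_series u l : lax_series u l = lax (u^~ l) :> (int -> K).
Proof. exact: lcoef_wlseries. Qed.

Lemma deg_le_derive_lax (u : nat -> K -> K) (l : K) :
  deg_le (-1) (fun k => derive1 (fun l' => lax (u^~ l') k) l).
Proof.
case=> [k|[|k]]// _.
by rewrite (_ : (fun l' => _) = cst ((k : int) == 1)%:R) ?derive1_cst.
Qed.

Lemma lcoef_lax_rate u l k :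
  lax_rate u l k = derive1 (fun l' => lax (u^~ l') k) l.
Proof. by rewrite (to_lseriesE (@deg_le_derive_lax u l)). Qed.

Lemma deg_le_lax_rate u l : deg_le (-1) (lax_rate u l).
Proof.
rewrite /lax_rate (to_lseriesE (@deg_le_derive_lax u l)).
exact: deg_le_derive_lax.
Qed.

(** Each coefficient of L depends on the times through lambda only, so the chain
    rule factors out the derivatives of lambda.  The coefficients of
    (L^n)_{>= 0} of negative index, and those of index above [n], are zero at
    all times, and so are their x-derivatives. *)
Lemma dKP_reduced_flow (T : set (times K)) (lam : times K -> K)
    (u : nat -> K -> K) n t :
    (forall t, T t -> forall n, (1 <= n)%N -> has_dt n lam t) ->
    (forall l, (lam @` T) l -> forall n, (2 <= n)%N -> derivable (u n) l 1) ->
    dKP_solution T (fun n t => u n (lam t)) -> T t -> (1 <= n)%N ->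
  (forall k, dt n (fun t' => lax (u^~ (lam t')) k) t =
     lax_rate u (lam t) k * dt n lam t) /\
  reduced_flow (lax_series u (lam t)) (lax_rate u (lam t)) n
    (dt n lam t) (dt 1 lam t).
Proof.
move=> lam_diff u_diff dKP Tt n1; set l := lam t.
have lT : (lam @` T) l by exists t.
have chain m : (1 <= m)%N -> forall k,
    dt m (fun t' => lax (u^~ (lam t')) k) t = lax_rate u l k * dt m lam t.
  move=> m1 k; rewrite lcoef_lax_rate.
  apply: (@dt_comp (fun l' => lax (u^~ l') k)); first exact: lam_diff.
  by case: k => k; [exact: derivable_cst|exact: u_diff].
split; first exact: chain.
have [_ flow] := dKP t Tt n n1.
set B := fun t' => snneg (sexp (lax (u^~ (lam t'))) n).
have B_bound k : k < 0 \/ n%:Z < k -> forall t', B t' k = 0.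
  move=> k_out t'; rewrite /B /snneg; case: ifP => // k0.
  rewrite -lcoef_lax_series -lcoef_exp.
  have L1 : monic_at 1 (lax_series u (lam t')) := @wlseries_monic _ _.
  by have := monic_at_deg_le (@monic_atX _ n _ _ L1); apply; lia.
have q_bound : deg_le n%:Z (sdx B t).
  by move=> k nk; apply: (@dt_cst _ _ _ 0) => t'; apply: B_bound; right.
exists (to_lseries (sdx B t)).
  move=> k k0; rewrite (to_lseriesE q_bound).
  by apply: (@dt_cst _ _ _ 0) => t'; apply: B_bound; left.
apply: lseriesP => k; rewrite lcoef_monoM subr0 mulrC -chain// flow.
rewrite mulrCA; set dL := mono _ 0 * lax_rate u l.
have dLE : lcoef dL = sdx (fun t' => lax (u^~ (lam t'))) t.
  by apply/funext => j; rewrite lcoef_monoM subr0 mulrC -chain.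
move: dL dLE => dL dLE.
rewrite lcoefB !lcoefM dLE (to_lseriesE q_bound) !lcoef_lderiv lcoef_nneg.
by rewrite lcoef_exp lcoef_lax_series.
Qed.

(** The time [t] where the reduction moves at the parameter value [l] provides
    D_1 different from 0, hence the driving value D_2 / (2 D_1). *)
Lemma genuine_loewner (T : set (times K)) (lam : times K -> K)
    (u : nat -> K -> K) l :
    (forall t, T t -> forall n, (1 <= n)%N -> has_dt n lam t) ->
    (forall l, (lam @` T) l -> forall n, (2 <= n)%N -> derivable (u n) l 1) ->
    dKP_solution T (fun n t => u n (lam t)) -> genuine_reduction T lam u ->
    (lam @` T) l ->
  exists c, wsub c * lax_rate u l =
      mono (lax_rate u l (-1)) 0 * D (lax_series u l) /\
    lax_rate u l (-1) != 0.
Proof.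
move=> lam_diff u_diff dKP genuine lT.
have [t [n [m [Tt lt n1 m2]]]] := genuine l lT.
have [chain flown] := dKP_reduced_flow lam_diff u_diff dKP Tt n1.
have [_ flow2] := dKP_reduced_flow lam_diff u_diff dKP Tt (isT : (1 <= 2)%N).
case: m m2 => [|[|m]]// _; have /= -> := chain (Negz m).
rewrite -lt in chain flown flow2 *.
set L := lax_series u _ in flown flow2 *.
set Ld := lax_rate u _ in chain flown flow2 *.
move=> moving.
have L1 : deg_le (-1) (L - mono 1 1) by exact: wlseries_rest.
have Ld1 : deg_le (-1) Ld by exact: deg_le_lax_rate.
have y0 : dt 1 lam t != 0.
  apply: contraNneq moving => y0; rewrite y0 in flown.
  have := reduced_flow_stationary L1 Ld1 flown.
  move=> /(congr1 (fun F : lseries K => F (Negz m))).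
  by rewrite lcoef_monoM subr0 lcoef0 mulrC => ->.
exists (dt 2 lam t / (2 * dt 1 lam t)).
have loewner := second_flow_loewner L1 Ld1 y0 flow2.
split=> //; apply: contraNneq moving => a0.
(* if u_2' vanished, the Loewner equation would give (w - c) Ld = 0 *)
suff -> : Ld = 0 by rewrite lcoef0 mul0r.
apply: (mulrI (monic_at_unit (monic_at_wsub (dt 2 lam t / (2 * dt 1 lam t))))).
rewrite loewner a0 mulr0.
have -> : mono 0 0 = 0 :> lseries K by [].
by rewrite mul0r.
Qed.

End Reduction.

Theorem proposition5p1 (K : numFieldType) (T : set (times K))
    (lam : times K -> K) (u : nat -> K -> K)
    (lam_diff : forall t, T t -> forall n, (1 <= n)%N -> has_dt n lam t)
    (u_diff : forall l, (lam @` T) l ->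
       forall n, (2 <= n)%N -> derivable (u n) l 1)
    (dKP : dKP_solution T (fun n t => u n (lam t)))
    (genuine : genuine_reduction T lam u) :
  exists U : K -> K,
    (forall l, (lam @` T) l -> chordal_loewner u U l) /\
    (forall kc : nat -> K -> K,
       let k l := wseries (kc^~ l) in
       (forall l, (lam @` T) l -> sinverse (lax (u^~ l)) (k l)) ->
       forall n, (1 <= n)%N -> forall t, T t ->
         let chi l := (deriv (faber (k l) n)).[U l] in
         dt n lam t = chi (lam t) * dt 1 lam t).
Proof.
have /choice[U UP] : forall l, exists c, (lam @` T) l ->
    wsub c * lax_rate u l =
      mono (lax_rate u l (-1)) 0 * lderiv (lax_series u l) /\
    lax_rate u l (-1) != 0.
  move=> l; have [lT|lT] := pselect ((lam @` T) l); last by exists 0.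
  by have [c] := genuine_loewner lam_diff u_diff dKP genuine lT; exists c.
exists U; split=> [l lT|kc k kinv n n1 t Tt].
  have [loewner _] := UP l lT; move=> k.
  have w1 := monic_at_wsub (U l).
  rewrite -lcoef_lax_rate.
  have -> : lax_rate u l =
      mono (lax_rate u l (-1)) 0 * (lderiv (lax_series u l) * (wsub (U l))^-1).
    by rewrite mulrA -loewner mulrAC mulrV ?mul1r// (monic_at_unit w1).
  rewrite lcoef_monoM subr0 mulrC lcoef_lax_rate; congr (_ * _).
  by rewrite inv_sub_wE -lcoef_lax_series -lcoef_lderiv -lcoefM mulrN lcoefN opprK.
have lT : (lam @` T) (lam t) by exists t.
have [loewner a0] := UP _ lT.
have [_ flow] := dKP_reduced_flow lam_diff u_diff dKP Tt n1.
have L1 : deg_le (-1) (lax_series u (lam t) - mono 1 1) by exact: wlseries_rest.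
move=> chi; rewrite (reduced_flow_speed L1 a0 loewner flow) mulrC; congr (_ * _).
have LX : monic_at 1 (lax_series u (lam t)) := monic_at_normalized L1.
have kX : monic_at 1 (wlseries (kc^~ (lam t))) by exact: wlseries_monic.
have kL : lcomp (wlseries (kc^~ (lam t))) (lax_series u (lam t)) = mono 1 1.
  have [_ kL] := kinv _ lT; apply: lseriesP => j.
  rewrite -scompE// lcoef_wlseries lcoef_lax_series kL lcoef_mono /smono.
  by case: eqP.
by rewrite -(@faber_deriv_residue _ _ _ (U (lam t)) n LX kX kL) lcoef_wlseries.
Qed.
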